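(* The space complexity of Zoom-SVD with block size $b$ for storing the data of a multiple time series with $c$ time series (storage as defined in the context) is $$O\Big(t\,k\Big(1+\frac{k}{b}+\frac{c}{b}\Big)\Big),$$ where $t$ is the total time length and $k$ is the number of singular values.
   Context: **Setting.** A multiple time series is a matrix $\mathbf{A}=[\mathbf{a}_1;\dots;\mathbf{a}_t]\in\mathbb{R}^{t\times c}$, where $[\,;\,]$ is vertical concatenation, $t$ is the total time length and $c$ is the number of time series. For a block size $b$, the $i$-th block ($i=0,1,2,\dots$) is $\mathbf{A}^{(i)}=[\mathbf{a}_{bi+1};\dots;\mathbf{a}_{bi+b}]\in\mathbb{R}^{b\times c}$. **Stored data.** Zoom-SVD discards the raw data and stores, for each of the $\lfloor t/b\rfloor$ completed blocks, the matrices of a truncated SVD result $\mathbf{A}^{(i)}\simeq\mathbf{U}_{(i)}\mathbf{\Sigma}_{(i)}\mathbf{V}_{(i)}^{T}$, with $\mathbf{U}_{(i)}\in\mathbb{R}^{b\times k_{(i)}}$ and $\mathbf{V}_{(i)}\in\mathbb{R}^{c\times k_{(i)}}$ column orthogonal and $\mathbf{\Sigma}_{(i)}\in\mathbb{R}^{k_{(i)}\times k_{(i)}}$ diagonal with the $k_{(i)}$ largest singular values in descending order. The number of retained singular values $k_{(i)}$ is the smallest $k$ such that the sum of squares of the $k$ largest singular values is at least a fraction $\xi$ of the sum of squares of all of them, for a fixed threshold $\xi\in(0,1)$. **Conventions.** Here $k$ is the number of singular values retained, a single symbol $k$ being used for all stored SVD results. Space is the total number of matrix entries stored. *)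

(* Defs.v *)
From HB Require Import structures.
From mathcomp Require Import all_boot all_order all_algebra.
From mathcomp Require Import reals.

Set Implicit Arguments.
Unset Strict Implicit.
Unset Printing Implicit Defensive.

Import Order.TTheory GRing.Theory Num.Theory.

Local Open Scope ring_scope.

Fact block_row_subproof (t b : nat) (i : 'I_(t %/ b)) (r : 'I_b) :
  (b * i + r < t)%N.
Proof.
apply: leq_trans (leq_divM t b).
apply: (@leq_trans (b * i.+1)).
  by rewrite mulnS [(b + _)%N]addnC ltn_add2l.
by rewrite mulnC leq_mul2r ltn_ord orbT.
Qed.

Definition block_row (t b : nat) (i : 'I_(t %/ b)) (r : 'I_b) : 'I_t :=
  Ordinal (block_row_subproof i r).

(* Row r of block i (both counted from 0) is row b * i + r of A.  The index i
   ranges over the completed blocks only. *)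
Definition block (R : realType) (t c b : nat) (A : 'M[R]_(t, c))
    (i : 'I_(t %/ b)) : 'M[R]_(b, c) :=
  rowsub (block_row i) A.

Definition column_orthogonal (R : realType) (m n : nat) (Q : 'M[R]_(m, n)) :=
  Q^T *m Q = 1%:M.

(* Thin singular value decomposition M = U diag(s) V^T: the entries of s are
   all the minn m n singular values of M, with multiplicity and including
   zeros, in descending order. *)
Definition is_svd (R : realType) (m n : nat) (M : 'M[R]_(m, n))
    (U : 'M[R]_(m, minn m n)) (s : 'rV[R]_(minn m n))
    (V : 'M[R]_(n, minn m n)) : Prop :=
  [/\ column_orthogonal U,
      column_orthogonal V,
      forall j, 0 <= s 0 j,
      forall j l : 'I_(minn m n), (j <= l)%N -> s 0 l <= s 0 j
    & M = U *m diag_mx s *m V^T].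

(* Sum of squares of the k leading entries; of all of them when r <= k. *)
Definition energy (R : realType) (r : nat) (s : 'rV[R]_r) (k : nat) : R :=
  \sum_(j < r | (j < k)%N) s 0 j ^+ 2.

Definition is_retained_number (R : realType) (xi : R) (r : nat)
    (s : 'rV[R]_r) (k : nat) : Prop :=
  xi * energy s r <= energy s k /\
  forall k' : nat, xi * energy s r <= energy s k' -> (k <= k')%N.

Record svd_result (R : realType) (m n : nat) := SVDResult {
  retained : nat;
  left_mx : 'M[R]_(m, retained);
  sigma_mx : 'M[R]_retained;
  right_mx : 'M[R]_(n, retained)
}.

(* The leading columns of an SVD of M, cut off at the threshold xi. *)
Definition is_truncated_svd (R : realType) (xi : R) (m n : nat)
    (M : 'M[R]_(m, n)) (D : svd_result R m n) : Prop :=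
  exists (U : 'M[R]_(m, minn m n)) (s : 'rV[R]_(minn m n))
         (V : 'M[R]_(n, minn m n)) (le_k : (retained D <= minn m n)%N),
    [/\ is_svd M U s V,
        is_retained_number xi s (retained D),
        left_mx D = colsub (widen_ord le_k) U,
        sigma_mx D = diag_mx (colsub (widen_ord le_k) s)
      & right_mx D = colsub (widen_ord le_k) V].

(* The data held by Zoom-SVD: one truncated SVD per completed block.  This is
   a relation since a matrix may have several SVDs. *)
Definition zoom_svd_stores (R : realType) (xi : R) (t c b : nat)
    (A : 'M[R]_(t, c)) (D : 'I_(t %/ b) -> svd_result R b c) : Prop :=
  forall i, is_truncated_svd xi (block A i) (D i).

Definition mx_entries (R : realType) (m n : nat) (M : 'M[R]_(m, n)) : nat :=
  (m * n)%N.

(* All entries of the diagonal matrix are counted, not just its diagonal. *)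
Definition svd_space (R : realType) (m n : nat) (D : svd_result R m n) : nat :=
  (mx_entries (left_mx D) + mx_entries (sigma_mx D)
   + mx_entries (right_mx D))%N.

Definition zoom_svd_space (R : realType) (t c b : nat)
    (D : 'I_(t %/ b) -> svd_result R b c) : nat :=
  (\sum_(i < t %/ b) svd_space (D i))%N.

(* Main.v *)
(* Each block costs at most k (b + k + c) entries, and there are at most t / b
   completed blocks; the product is t k (1 + k / b + c / b), so C = 1. *)

Require Import Defs.
From HB Require Import structures.
From mathcomp Require Import all_boot all_order all_algebra.
From mathcomp Require Import reals.

Set Implicit Arguments.
Unset Strict Implicit.
Unset Printing Implicit Defensive.

Import Order.TTheory GRing.Theory Num.Theory.

Local Open Scope ring_scope.

(** A block with [r <= k] retained values stores [b r + r^2 + c r] entries; this grows with [r], so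
    it is at most [k (b + k + c)]. Summing over the completed blocks ([zoom_svd_space_le]), whose
    number is at most the exact quotient [t / b], gives the bound with constant 1. *)

Lemma svd_space_le (R : realType) (m n k : nat) (D : svd_result R m n) :
  (retained D <= k)%N -> (svd_space D <= k * (m + k + n))%N.
Proof.
move=> le_k; rewrite /svd_space /mx_entries !mulnDr [(k * m)%N]mulnC.
by rewrite [(k * n)%N]mulnC !leq_add ?leq_mul.
Qed.

Lemma zoom_svd_space_le (R : realType) (t c b k : nat)
    (D : 'I_(t %/ b) -> svd_result R b c) :
  (forall i, (retained (D i) <= k)%N) ->
  (zoom_svd_space D <= t %/ b * (k * (b + k + c)))%N.
Proof.
move=> le_k; rewrite -[X in (_ <= X * _)%N]card_ord -sum_nat_const.
by apply: leq_sum => i _; apply: svd_space_le.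
Qed.

Theorem theorem3 (R : realType) :
  exists C : R, 0 < C /\
    forall (t c b k : nat) (xi : R) (A : 'M[R]_(t, c))
           (D : 'I_(t %/ b) -> svd_result R b c),
      (0 < b)%N ->
      0 < xi < 1 ->
      zoom_svd_stores xi A D ->
      (forall i : 'I_(t %/ b), (retained (D i) <= k)%N) ->
      (zoom_svd_space D)%:R
        <= C * (t%:R * k%:R * (1 + k%:R / b%:R + c%:R / b%:R)).
Proof.
exists 1; split=> [|t c b k xi A D b_gt0 _ _ le_k]; first exact: ltr01.
have b_pos : 0 < b%:R :> R by rewrite ltr0n.
(* Multiplying by [b] turns [1 + k/b + c/b] into [b + k + c], leaving an inequality between
   naturals. *)
rewrite mul1r -(ler_pM2r b_pos) -[X in _ <= X]mulrA.
rewrite !mulrDl mul1r !divfK ?gt_eqF //.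
rewrite -!natrD -!natrM ler_nat -mulnA.
apply: leq_trans (leq_mul (zoom_svd_space_le le_k) (leqnn b)) _.
(* The completed blocks cover at most [t] rows: [t %/ b * b <= t]. *)
by rewrite mulnAC leq_mul2r leq_divM orbT.
Qed.
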